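(* If a topological group $G$ is weakly proximally simulated by some discretely amenable subgroup, then $G$ is skew-amenable.
   Context: For a topological group $G$ and $g\in G$ let $\lambda_g\colon G\to G,\ x\mapsto gx$. $\mathrm{LUCB}(G)$ is the algebra of bounded functions $f\colon G\to\mathbb{R}$ that are left-uniformly continuous, i.e., for every $\epsilon>0$ there is a neighborhood $U$ of the neutral element with $|f(x)-f(y)|\le\epsilon$ whenever $x^{-1}y\in U$. A mean on $\mathrm{LUCB}(G)$ is a positive linear functional $\mu$ with $\mu(\mathbf 1)=1$. $G$ is skew-amenable if $\mathrm{LUCB}(G)$ admits a mean $\mu$ with $\mu(f\circ\lambda_g)=\mu(f)$ for all $f\in\mathrm{LUCB}(G)$, $g\in G$. A subgroup is discretely amenable if it is amenable as a discrete group (i.e., forgetting the topology). $G$ is weakly proximally simulated by a subgroup $H\leq G$ if for every finite $E\subseteq G$, every finite $F\subseteq\mathrm{LUCB}(G)$ and every $\epsilon>0$ there exists a family $(h_g)_{g\in E}\in H^E$ such that for every finite $S\subseteq H$ there is $t\in G$ with $|f(gst)-f(h_gst)|<\epsilon$ for all $g\in E$, $s\in S$, $f\in F$. *)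

(* Defs.v *)
From HB Require Import structures.
From mathcomp Require Import all_boot all_order all_algebra.
From mathcomp Require Import all_classical all_reals all_analysis.

Set Implicit Arguments.
Unset Strict Implicit.
Unset Printing Implicit Defensive.

Import Order.TTheory GRing.Theory Num.Theory.
Import numFieldNormedType.Exports.

Local Open Scope classical_set_scope.
Local Open Scope ring_scope.

(* No separation axiom is required. *)
HB.mixin Record isTopologicalGroup G of Topological G & Group G := {
  mulg_continuous : continuous (fun x : G * G => (x.1 * x.2)%g);
  invg_continuous : continuous (fun x : G => x^-1%g)
}.

#[short(type="topologicalGroupType")]
HB.structure Definition TopologicalGroup :=
  {G of Topological G & Group G & isTopologicalGroup G}.

(* A subgroup H of G, seen as a group of its own (without a topology).
   Membership in [H : groupClosed G] is boolean; classically this covers all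
   subgroups of G. *)
Definition subgroup_of (G : groupType) (H : groupClosed G) : Type :=
  {x : G | x \in H}.

Section SubgroupOf.
Variables (G : groupType) (H : groupClosed G).

HB.instance Definition _ := SubChoice.on (subgroup_of H).

Fact groupClosed_group_closed : group_closed H.
Proof. by split; [exact: gpred1 | exact: gpredF]. Qed.

HB.instance Definition _ :=
  SubChoice_isSubGroup.Build G _ (subgroup_of H) groupClosed_group_closed.

End SubgroupOf.

Definition lambda (G : groupType) (g : G) : G -> G := fun x => (g * x)%g.

Section Amenability.
Variable R : realType.

(* [A] is meant to be a linear space of functions containing the constants;
   [mu] represents a functional on [A], its values outside [A] are irrelevant. *)
Definition is_mean (X : Type) (A : set (X -> R)) (mu : (X -> R) -> R) : Prop :=
  [/\ forall (a : R) (f h : X -> R), A f -> A h ->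
        mu (fun x => a * f x + h x) = a * mu f + mu h,
      forall f : X -> R, A f -> (forall x, 0 <= f x) -> 0 <= mu f &
      mu (fun=> 1) = 1].

Definition has_invariant_mean (G : groupType) (A : set (G -> R)) : Prop :=
  exists2 mu : (G -> R) -> R, is_mean A mu &
    forall (f : G -> R) (g : G), A f -> mu (f \o lambda g) = mu f.

Definition left_unif_continuous (G : topologicalGroupType) (f : G -> R) : Prop :=
  forall e : R, 0 < e -> exists2 U : set G, nbhs (1%g : G) U &
    forall x y : G, U (x^-1 * y)%g -> `|f x - f y| <= e.

Definition LUCB (G : topologicalGroupType) : set (G -> R) :=
  [set f | bounded_fun f /\ left_unif_continuous f].

Definition skew_amenable (G : topologicalGroupType) : Prop :=
  has_invariant_mean (@LUCB G).

Definition amenable (G : groupType) : Prop :=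
  has_invariant_mean [set f : G -> R | bounded_fun f].

Definition discretely_amenable (G : groupType) (H : groupClosed G) : Prop :=
  amenable (subgroup_of H).

Definition weakly_proximally_simulated (G : topologicalGroupType)
    (H : groupClosed G) : Prop :=
  forall (E : set G) (F : set (G -> R)) (e : R),
    finite_set E -> finite_set F -> F `<=` @LUCB G -> 0 < e ->
  exists2 h : G -> G, (forall g, E g -> h g \in H) &
    forall S : set G, finite_set S -> (forall s, S s -> s \in H) ->
    exists t : G, forall g s f, E g -> S s -> F f ->
      `|f (g * s * t)%g - f (h g * s * t)%g| < e.

End Amenability.

(* Main.v *)
Require Import Defs.
From mathcomp Require Import all_boot all_order all_algebra.
From mathcomp Require Import all_classical all_reals all_analysis.
From mathcomp Require Import finmap.
From mathcomp.analysis.showcase Require Import summability.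

(** Let [m] be an invariant mean on the simulating subgroup [H], and fix finite
    sets [E] of group elements, [F] of functions, and [e > 0].  Simulation
    gives [h : E -> H] and, for each finite [S], a point [t S] of [G].  Choose
    a mean [L] on bounded functions of [S] that only sees large [S] (a limit
    along an ultrafilter), and set

      [mu f := m (s |-> L (S |-> f (s * t S)))].

    For [g] in [E], [f] in [F] and [s] in [H], the functions
    [S |-> f (g * s * t S)] and [S |-> f (h g * s * t S)] are [e]-close as soon
    as [s] belongs to [S], so [mu (f \o lambda g)] is [e]-close to the value of
    [m] at [s |-> L (S |-> f (h g * s * t S))].  The latter function is the
    [h g]-translate of [s |-> L (S |-> f (s * t S))], so invariance of [m]
    identifies this value with [mu f]: see [almost_invariant_mean].  A second
    limit of the same kind, now over [E], [F] and [e], turns these almost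
    invariant means into an invariant one: for fixed [f] and [g], the defect
    [`|mu (f \o lambda g) - mu f|] is eventually at most any given [e].

    Both limits are instances of [mean_along_filter], and in both cases the
    functional obtained is an average of means, hence a mean by
    [is_mean_average]. *)

Set Implicit Arguments.
Unset Strict Implicit.
Unset Printing Implicit Defensive.

Import Order.TTheory GRing.Theory Num.Theory.
Import numFieldNormedType.Exports.

Local Open Scope classical_set_scope.
Local Open Scope ring_scope.

#[local] Existing Instance totally_filter.

(** * Means on bounded functions *)

Section BoundedMeans.
Variable R : realType.

Lemma bounded_funE (X : Type) (f : X -> R) :
  bounded_fun f <-> exists M : R, forall x, `|f x| <= M.
Proof.
split=> [/pinfty_ex_gt0[M _ fM]|[M fM]].
  by exists M => x; exact: fM.
exists M; split; first exact: num_real.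
by move=> N MN x _; exact: le_trans (fM x) (ltW MN).
Qed.

Lemma bounded_fun_comp (X Y : Type) (f : X -> R) (p : Y -> X) :
  bounded_fun f -> bounded_fun (fun y => f (p y)).
Proof. by move=> /bounded_funE[M fM]; apply/bounded_funE; exists M. Qed.

Lemma bounded_fun_lin (X : Type) (a : R) (f h : X -> R) :
  bounded_fun f -> bounded_fun h -> bounded_fun (fun x => a * f x + h x).
Proof.
move=> /bounded_funE[M fM] /bounded_funE[N hN]; apply/bounded_funE.
exists (`|a| * M + N) => x; apply: le_trans (ler_normD _ _) _.
by rewrite normrM lerD// ler_wpM2l.
Qed.

Lemma bounded_fun_cst (X : Type) (c : R) : bounded_fun (fun _ : X => c).
Proof. by apply/bounded_funE; exists `|c|. Qed.

Definition bounded_mean (X : Type) (mu : (X -> R) -> R) : Prop :=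
  is_mean [set f : X -> R | bounded_fun f] mu.

Section Properties.
Variables (X : Type) (mu : (X -> R) -> R).
Hypothesis mean_mu : bounded_mean mu.

Lemma mean_cst (c : R) : mu (fun=> c) = c.
Proof.
case: mean_mu => mu_lin _ mu1.
have mu0 : mu (fun=> 0) = 0.
  have := mu_lin (-1) (fun=> 1) (fun=> 1) (bounded_fun_cst _ _)
    (bounded_fun_cst _ _).
  by rewrite mu1 !mulN1r addNr.
have := mu_lin c (fun=> 1) (fun=> 0) (bounded_fun_cst _ _)
  (bounded_fun_cst _ _).
by rewrite mu1 mu0 mulr1 !addr0.
Qed.

Lemma meanB (f h : X -> R) : bounded_fun f -> bounded_fun h ->
  mu (fun x => f x - h x) = mu f - mu h.
Proof.
case: mean_mu => mu_lin _ _ bf bh; rewrite addrC -mulN1r -mu_lin//.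
by congr mu; apply/funext => x; rewrite mulN1r addrC.
Qed.

Lemma mean_le (f h : X -> R) : bounded_fun f -> bounded_fun h ->
  (forall x, f x <= h x) -> mu f <= mu h.
Proof.
move=> bf bh fh; rewrite -subr_ge0 -meanB//; case: mean_mu => _ + _; apply.
  rewrite /=; have -> : (fun x => h x - f x) = (fun x => -1 * f x + h x).
    by apply/funext => x; rewrite mulN1r addrC.
  exact: bounded_fun_lin.
by move=> x; rewrite subr_ge0.
Qed.

Lemma mean_norm_le (f : X -> R) (c : R) :
  (forall x, `|f x| <= c) -> `|mu f| <= c.
Proof.
move=> fc; have bf : bounded_fun f by apply/bounded_funE; exists c.
rewrite ler_norml -[X in _ && (_ <= X)]mean_cst -[X in X <= _]mean_cst.
by apply/andP; split; apply: mean_le => // [|x];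
  do ?[exact: bounded_fun_cst]; have := fc x; rewrite ler_norml => /andP[].
Qed.

Lemma mean_dist_le (f h : X -> R) (c : R) : bounded_fun f -> bounded_fun h ->
  (forall x, `|f x - h x| <= c) -> `|mu f - mu h| <= c.
Proof. by move=> bf bh fh; rewrite -meanB//; exact: mean_norm_le. Qed.

End Properties.

Lemma bounded_fun_means (X Y : Type) (k : X -> (Y -> R) -> R) (f : Y -> R) :
  (forall x, bounded_mean (k x)) -> bounded_fun f ->
  bounded_fun (fun x => k x f).
Proof.
move=> mk /bounded_funE[M fM]; apply/bounded_funE.
by exists M => x; exact: mean_norm_le.
Qed.

(** This is the composition of the Markov kernel [k] with [m], the means being
    thought of as finitely additive probability measures. *)
Lemma is_mean_average (X Y : Type) (m : (X -> R) -> R)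
    (k : X -> (Y -> R) -> R) :
  bounded_mean m -> (forall x, bounded_mean (k x)) ->
  bounded_mean (fun f => m (fun x => k x f)).
Proof.
move=> mm mk; have [m_lin m_ge0 m1] := mm; split.
- move=> a f h bf bh; rewrite -m_lin; first last.
  + exact: bounded_fun_means.
  + exact: bounded_fun_means.
  congr m; apply/funext => x.
  by case: (mk x) => + _ _; apply.
- move=> f bf f0; apply: m_ge0; first exact: bounded_fun_means.
  by move=> x; case: (mk x) => _ + _; apply.
- rewrite -[RHS]m1; congr m; apply/funext => x.
  by case: (mk x).
Qed.

Lemma is_mean_image (X Y : Type) (m : (X -> R) -> R) (p : X -> Y) :
  bounded_mean m -> bounded_mean (fun f => m (fun x => f (p x))).
Proof.
move=> [m_lin m_ge0 m1]; split => //.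
- by move=> a f h bf bh; rewrite m_lin//; exact: bounded_fun_comp.
- by move=> f bf f0; apply: m_ge0 => //; exact: bounded_fun_comp.
Qed.

(** * Means concentrated along a filter *)

(** Boundedness puts the values of [f] in a compact segment, where they cluster;
    an ultrafilter cannot cluster without converging. *)
Lemma ultra_bounded_cvg (I : Type) (U : set_system I) (f : I -> R) :
  UltraFilter U -> bounded_fun f -> cvg (f @ U).
Proof.
move=> UU /bounded_funE[M fM].
have PU : ProperFilter U by exact: ultra_proper.
have fU : (f @ U) `[- M, M]%classic.
  by apply: nearW => i; rewrite /= in_itv/= -ler_norml.
have [p [_ clp]] := segment_compact (fmap_proper_filter f PU) fU.
apply/cvg_ex; exists p => V pV.
have [//|fNV] := in_ultra_setVsetC (f @^-1` V) UU.
by have [x []] := clp (~` V) V fNV pV.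
Qed.

(** The mean is the limit along an ultrafilter refining [F]. *)
Lemma mean_along_filter (I : Type) (F : set_system I) : ProperFilter F ->
  exists2 L : (I -> R) -> R, bounded_mean L &
    forall f c, bounded_fun f -> (\forall i \near F, `|f i| <= c) ->
      `|L f| <= c.
Proof.
move=> PF; have [U [UU FU]] := ultraFilterLemma PF.
have PU : ProperFilter U by exact: ultra_proper.
exists (fun f => lim (f @ U)).
  split.
  - move=> a f h bf bh; apply/cvg_lim => //.
    apply: cvgD; last exact: ultra_bounded_cvg.
    by apply: cvgM; [exact: cvg_cst|exact: ultra_bounded_cvg].
  - move=> f bf f0; apply: limr_ge; first exact: ultra_bounded_cvg.
    by apply: nearW.
  - exact: lim_cst.
move=> f c bf fc; have cf := ultra_bounded_cvg UU bf.
rewrite ler_norml; apply/andP; split; [apply: limr_ge|apply: limr_le] => //;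
  apply: FU; apply: filterS fc => i; by rewrite ler_norml => /andP[].
Qed.

End BoundedMeans.

Lemma near_totally (I : choiceType) (x : I) :
  \forall S \near totally, x \in S.
Proof. by exists [fset x]%fset => // S; rewrite /= fsub1set. Qed.

(** * Almost invariant means *)

Section Simulation.
Variables (R : realType) (G : topologicalGroupType).

Lemma lambda_LUCB (g : G) (f : G -> R) :
  LUCB f -> LUCB (f \o lambda g).
Proof.
move=> [bf uf]; split; first exact: bounded_fun_comp.
move=> e /uf[U U1 Uf]; exists U => // x y Uxy; apply: Uf.
by rewrite /lambda invgM -mulgA mulKg.
Qed.

(** This is the convolution [mu f := m (s |-> L (S |-> f (s * t S)))], where
    [t S] simulates [E] on the finite set [S] and [L] is concentrated on large
    [S]. *)
Lemma almost_invariant_mean (H : groupClosed G) (E : set G)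
    (F : set (G -> R)) (e : R) :
  discretely_amenable R H -> weakly_proximally_simulated R H ->
  finite_set E -> finite_set F -> F `<=` @LUCB R G -> 0 < e ->
  exists2 mu : (G -> R) -> R, bounded_mean mu &
    forall g f, E g -> F f -> `|mu (f \o lambda g) - mu f| <= e.
Proof.
move=> [m mm m_inv] sim finE finF FLUCB e0.
have [h hH hS] := sim E F e finE finF FLUCB e0.
have /choice[t tP] : forall S : {fset G}, exists t : G, forall g s f,
    E g -> s \in S -> s \in H -> F f ->
    `|f (g * s * t)%g - f (h g * s * t)%g| < e.
  move=> S; have [||t tP] := hS [set s | s \in S /\ s \in H].
  - by apply: sub_finite_set (finite_fset S) => s [].
  - by move=> s [].
  - by exists t => g s f Eg sS sH Ff; exact: tP.
have [L mL L_near] := mean_along_filter R (F := @totally G) _.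
pose k (x : G) (f : G -> R) := L (fun S => f (x * t S)%g).
have mk x : bounded_mean (k x) by exact: is_mean_image.
exists (fun f => m (fun s : subgroup_of H => k (val s) f)).
  exact: (is_mean_average mm (fun s => mk (val s))).
move=> g f Eg Ff; have [bf _] := FLUCB _ Ff.
have bfs (x : G) : bounded_fun (fun S : {fset G} => f (x * t S)%g).
  exact: bounded_fun_comp.
pose hg : subgroup_of H := exist _ (h g) (hH g Eg).
(* Left translation by [h g] inside [H] is absorbed by [m]. *)
rewrite -(m_inv (fun s : subgroup_of H => k (val s) f) hg); last first.
  exact: (bounded_fun_means (fun s => mk (val s))).
apply: mean_dist_le => //.
- apply: (bounded_fun_means (fun s => mk (val s))).
  exact: (bounded_fun_comp (lambda g) bf).
- exact: (bounded_fun_means (fun s => mk (val (lambda hg s)))).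
move=> s; rewrite /k.
rewrite -(meanB mL (f := fun S => (f \o lambda g) (val s * t S)%g)); first last.
- exact: bfs.
- exact: (bounded_fun_comp (fun S => lambda g (val s * t S)%g) bf).
apply: L_near.
  apply/bounded_funE; have /bounded_funE[M fM] := bf.
  exists (M + M) => S; apply: le_trans (ler_normB _ _) _.
  by apply: lerD; exact: fM.
apply: filterS (near_totally (val s)) => S sS.
by rewrite /= /lambda mulgA; apply/ltW/tP => //; exact: valP.
Qed.

End Simulation.

Theorem corollary7p6 (R : realType) (G : topologicalGroupType) :
  (exists2 H : groupClosed G,
     discretely_amenable R H & weakly_proximally_simulated R H) ->
  skew_amenable R G.
Proof.
move=> [H amH simH].
(* A finite set [A] of pairs [(g, f)] encodes the finite sets [E] and [F]; the
   second components outside [LUCB] have to be discarded. *)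
pose E (A : {fset G * (G -> R)}) : set G := [set p.1 | p in [set` A]].
pose F (A : {fset G * (G -> R)}) : set (G -> R) :=
  [set p.2 | p in [set` A]] `&` @LUCB R G.
have /choice[mu muP] : forall i : {fset G * (G -> R)} * nat,
    exists mu : (G -> R) -> R, bounded_mean mu /\
      forall g f, E i.1 g -> F i.1 f ->
        `|mu (f \o lambda g) - mu f| <= i.2.+1%:R^-1.
  move=> [A n]; have [|||//|mu mmu muP] :=
    almost_invariant_mean (E := E A) (F := F A) (e := n.+1%:R^-1) amH simH.
  - exact: finite_image.
  - by apply: finite_setIl; exact: finite_image.
  - by move=> f [].
  - by exists mu.
have mmu i : bounded_mean (mu i) by case: (muP i).
have [L mL L_near] := mean_along_filter R
  (F := filter_prod (@totally (G * (G -> R))%type) \oo) _.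
exists (fun f => L (fun i => mu i f)).
  have [lin pos one] := is_mean_average mL mmu; split => //.
  - by move=> a f h [bf _] [bh _]; exact: lin.
  - by move=> f [bf _]; exact: pos.
move=> f g lf; have [bf _] := lf; have [bfg _] := lambda_LUCB g lf.
apply/eqP; rewrite -subr_eq0 -normr_le0; apply/ler_addgt0Pl => e e0.
rewrite addr0 -meanB//; [|exact: bounded_fun_means..].
apply: L_near.
  apply/bounded_funE; have /bounded_funE[M fM] := bf.
  exists (M + M) => i; apply: le_trans (ler_normB _ _) _.
  by rewrite lerD//; apply: mean_norm_le => // x; exact: fM.
near=> i; have [_ inv_i] := muP i.
have gfi : (g, f) \in i.1.
  by near: i; exact: (cvg_fst (near_totally (g, f))).
apply: le_trans (inv_i _ _ _ _) _; [by exists (g, f)| |].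
  by split => //; exists (g, f).
apply: ltW; near: i; exact: (cvg_snd (near_infty_natSinv_lt (PosNum e0))).
Unshelve. all: by end_near. Qed.
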